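(* Let $0<a<b$ and let $K=[ia,ib]\cup[-ia,-ib]\subset\mathbb{C}$. Then the asymptotic convergence factor of $K$ is $$\underline{\rho}(K)=\sqrt{\frac{b-a}{b+a}}.$$
   Context: For $z,w\in\mathbb{C}$, $[z,w]$ denotes the closed segment joining $z$ and $w$. For an integer $t\ge1$, $\mathcal{P}_t$ is the set of real polynomials $p$ of degree at most $t$ with $p(0)=1$. For a compact set $K\subset\mathbb{C}$ symmetric with respect to the real axis, the asymptotic convergence factor is $$\underline{\rho}(K)=\inf_{t\ge1}\ \min_{p_t\in\mathcal{P}_t}\ \max_{\lambda\in K}|p_t(\lambda)|^{1/t}.$$ *)

(* Defs.v *)
From mathcomp Require Import all_boot all_order all_algebra.
From mathcomp Require Import all_classical all_reals all_analysis.
From mathcomp Require Import complex.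

Set Implicit Arguments.
Unset Strict Implicit.
Unset Printing Implicit Defensive.

Import Order.TTheory GRing.Theory Num.Theory.

Local Open Scope classical_set_scope.
Local Open Scope ring_scope.
Local Open Scope complex_scope.

Definition segment (R : realType) (z w : R[i]) : set R[i] :=
  [set (1 - s)%:C * z + s%:C * w | s in [set s : R | 0 <= s <= 1]].

(* [size p <= t.+1] says that p has degree at most t. *)
Definition normalized_polys (R : realType) (t : nat) : set {poly R} :=
  [set p : {poly R} | (size p <= t.+1)%N /\ p.[0] = 1].

(* The modulus of p(lambda) is taken as a real number: the norm [`|_|] of
   R[i] is R[i]-valued, whereas [ComplexField.Normc.normc] is its R-valued
   version. *)
Definition modulus_at (R : realType) (p : {poly R}) (lambda : R[i]) : R :=
  ComplexField.Normc.normc (map_poly (real_complex R) p).[lambda].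

(* Meant for a nonempty compact K that is symmetric with respect to the real
   axis.  For such a K the function lambda |-> |p(lambda)|^(1/t) is bounded on
   K, and the inner [inf] and the [sup] are a minimum and a maximum. *)
Definition asymptotic_convergence_factor (R : realType) (K : set R[i]) : R :=
  inf [set inf [set sup [set modulus_at p lambda `^ (t%:R)^-1 | lambda in K]
               | p in @normalized_polys R t]
      | t in [set t : nat | (1 <= t)%N]].

(* Main.v *)
(* On the imaginary axis the even and odd parts of a real polynomial [p] give
   the real and imaginary parts of [p (i y)], so [|p (i y)|] is at least
   [|e (- y^2)|] for [p = e (X^2) + X o (X^2)]; thus [e], of degree at most
   [t/2], must be small on [[-b^2, -a^2]] with [e 0 = 1].  The optimal [e] is the
   Chebyshev polynomial [T_n] transported to that interval, where 0 corresponds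
   to [x0 = (b^2+a^2)/(b^2-a^2) = (k + 1/k)/2] for [k = (b-a)/(b+a)].  From
   [1/(2 k^n) <= T_n(x0) <= 1/k^n] the minimax value lies between [k^n] and
   [2 k^n] with [n = t/2], and its [t]-th root tends to [sqrt k] from above. *)

Require Import Defs.
From mathcomp Require Import all_boot all_order all_algebra.
From mathcomp Require Import all_classical all_reals all_analysis.
From mathcomp Require Import complex.
From mathcomp Require polyrcf.
From mathcomp Require Import ring lra.

Import Order.TTheory GRing.Theory Num.Theory.

Local Open Scope classical_set_scope.
Local Open Scope ring_scope.
Local Open Scope complex_scope.

Set Implicit Arguments.
Unset Strict Implicit.

(** * Chebyshev polynomials: degree and closed forms *)

Lemma size_comp_poly_le (R : nzRingType) (p q : {poly R}) (d e : nat) :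
  (size p <= d.+1)%N -> (size q <= e.+1)%N -> (size (p \Po q) <= (d * e).+1)%N.
Proof.
move=> sp sq; rewrite (leq_trans (size_comp_poly_leq _ _))// ltnS.
by rewrite leq_mul// -subn1 leq_subLR.
Qed.

Fixpoint chebyshev (R : comNzRingType) (n : nat) : {poly R} :=
  match n with
  | 0 => 1
  | 1 => 'X
  | (n1.+1 as n0).+1 => 'X * chebyshev R n0 *+ 2 - chebyshev R n1
  end.

Arguments chebyshev : clear implicits.

Lemma size_chebyshev (R : comNzRingType) (n : nat) :
  (size (chebyshev R n) <= n.+1)%N.
Proof.
elim/ltn_ind: n => -[|[|n]] IH; first by rewrite size_polyC oner_eq0.
  by rewrite size_polyX.
rewrite [chebyshev _ _]/= -/(chebyshev R n.+1).
rewrite (leq_trans (size_polyD _ _))// geq_max size_polyN; apply/andP; split.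
  rewrite mulr2n (leq_trans (size_polyD _ _))// maxnn mulrC.
  have [->|nz] := eqVneq (chebyshev R n.+1) 0; first by rewrite mul0r size_poly0.
  by rewrite size_mulX// ltnS IH.
by rewrite (leq_trans (IH n _))// ltnW.
Qed.

(** Reduces a closed form of [T_n] to its three-term recurrence; it serves both the cosine form and
    the Joukowski form. *)
Lemma horner_chebyshev_rec (R : comNzRingType) (x : R) (f : nat -> R) :
    f 0%N = 1 -> f 1%N = x ->
    (forall n, f n.+2 = x * f n.+1 *+ 2 - f n) ->
  forall n, (chebyshev R n).[x] = f n.
Proof.
move=> f0 f1 fS; elim/ltn_ind => -[|[|n]] IH; rewrite ?hornerC ?hornerX//.
rewrite [chebyshev _ _]/= -/(chebyshev R n.+1) fS.
by rewrite hornerD hornerN hornerMn hornerM hornerX !IH.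
Qed.

Lemma chebyshev_cos (R : realType) (n : nat) (u : R) :
  (chebyshev R n).[cos u] = cos (n%:R * u).
Proof.
move: n; apply: horner_chebyshev_rec => [||n]; rewrite ?mul0r ?cos0 ?mul1r//.
have -> : n.+2%:R * u = n.+1%:R * u + u by rewrite -(natr1 n.+1); ring.
have -> : n%:R * u = n.+1%:R * u - u by rewrite -(natr1 n); ring.
by rewrite cosD cosB; ring.
Qed.

(** The map [z |-> (z + z^-1) / 2] replaces the cosine in order to reach arguments beyond
    [[-1, 1]]. *)
Lemma chebyshev_joukowski (F : numFieldType) (n : nat) (z : F) : z != 0 ->
  (chebyshev F n).[(z + z^-1) / 2] = (z ^+ n + z ^- n) / 2.
Proof.
move=> z0; move: n; apply: horner_chebyshev_rec => [||n].
- by rewrite expr0 invr1; field.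
- by rewrite expr1.
- by rewrite !exprS; field; rewrite expf_neq0.
Qed.

Lemma chebyshev_le1 (R : realType) (n : nat) (x : R) : -1 <= x <= 1 ->
  `|(chebyshev R n).[x]| <= 1.
Proof.
by move=> x1; rewrite -[x]acosK ?in_itv// chebyshev_cos cos_max.
Qed.

(** * Alternation and the extremal property *)

(** The intermediate value theorem gives a root in each gap. The bound by [x 0] keeps the roots
    distinct in the induction: the new root exceeds [x 1], the earlier ones do not. *)
Lemma alternating_roots (R : rcfType) (p : {poly R}) (x : nat -> R) (n : nat) :
    (forall k, (k < n)%N -> x k.+1 < x k) ->
    (forall k, (k < n)%N -> p.[x k] * p.[x k.+1] < 0) ->
  exists rs : seq R,
    [/\ size rs = n, uniq rs, all (root p) rs & all (< x 0%N) rs].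
Proof.
elim: n x => [|n IH] x xlt xsg; first by exists [::].
have [|k kn|rs [srs urs rrs ltrs]] := IH (x \o succn).
- by move=> k kn; exact: xlt.
- exact: xsg.
have sg0 : p.[x 1%N] * p.[x 0%N] < 0 by rewrite mulrC xsg.
have [r] := polyrcf.poly_ivtoo (ltW (xlt 0%N isT)) sg0.
rewrite in_itv/= => /andP[r1 r0] rr.
exists (r :: rs); split; rewrite /= ?srs ?urs ?rr ?rrs ?r0 ?andbT//=.
  by apply/negP => /(allP ltrs)/=; rewrite ltNge (ltW r1).
by apply/allP => s /(allP ltrs)/= s1; rewrite (lt_trans s1)// xlt.
Qed.

(* Otherwise [T_n - T_n(x0) q] would have the root [x0 > 1] besides the [n]
   roots separating the points [cos (k pi / n)], at which [T_n] is [(-1)^k]. *)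
Lemma chebyshev_extremal (R : realType) (n : nat) (q : {poly R}) (x0 : R) :
    (size q <= n.+1)%N -> 1 < x0 -> q.[x0] = 1 ->
  exists2 x : R, -1 <= x <= 1 & 1 <= `|(chebyshev R n).[x0] * q.[x]|.
Proof.
move=> sq x0_gt1 qx0; apply: contrapT => noX.
set t := (chebyshev R n).[x0] in noX *.
have small (x : R) : -1 <= x <= 1 -> `|t * q.[x]| < 1.
  by move=> hx; rewrite ltNge; apply/negP => h; apply: noX; exists x.
pose node (k : nat) : R := cos (k%:R * (pi / n%:R)).
have Tnode k : (0 < n)%N -> (chebyshev R n).[node k] = (-1) ^+ k.
  move=> n0; rewrite chebyshev_cos.
  have -> : n%:R * (k%:R * (pi / n%:R)) = k%:R * pi :> R.
    by field; rewrite pnatr_eq0 -lt0n.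
  elim: k => [|k IH]; first by rewrite mul0r cos0.
  by rewrite -natr1 mulrDl mul1r cosDpi IH exprS mulN1r.
have node1 k : -1 <= node k <= 1 by rewrite -ler_norml cos_max.
pose d := chebyshev R n - t *: q.
have sd : (size d <= n.+1)%N.
  rewrite (leq_trans (size_polyD _ _))// geq_max size_chebyshev size_polyN.
  by rewrite (leq_trans (size_scale_leq _ _)).
have dE x : d.[x] = (chebyshev R n).[x] - t * q.[x] by rewrite !hornerE.
(* Since [T_n] is 1 at 1, [d] is nonzero. This also covers [n = 0], where no gaps exist and the
   single root [x0] already contradicts the degree. *)
have d1 : d.[1] != 0.
  have : `|t * q.[1]| < 1 by apply: small; lra.
  rewrite dE -[in X in X - _]cos0 chebyshev_cos mulr0 cos0 ltr_norml => h.
  by apply/eqP; lra.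
have dx0 : root d x0 by rewrite /root dE qx0 mulr1 subrr.
have dn0 : d != 0 by apply: contra_neq d1 => ->; rewrite horner0.
have [k kn|k kn|rs [srs urs rrs ltrs]] := @alternating_roots _ d node n.
- have n0 : 0 < n%:R :> R by rewrite ltr0n (leq_trans _ kn).
  have hpi := pi_gt0 R.
  have inpi j : (j <= n)%N -> j%:R * (pi / n%:R) \in `[0, pi :> R].
    move=> jn; rewrite in_itv/= mulr_ge0 ?divr_ge0// ?(ltW hpi)//= mulrCA.
    by rewrite ler_piMr ?(ltW hpi)// ler_pdivrMr// mul1r ler_nat.
  rewrite /node ltr_cos ?inpi// ?(ltnW kn)//.
  by rewrite ltr_pM2r ?divr_gt0// ltr_nat.
- have n0 : (0 < n)%N by rewrite (leq_trans _ kn).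
  (* At a node [T_n] is 1 or -1 while [t * q] is strictly smaller in modulus, so [d] has the sign of
     [T_n] there. *)
  rewrite !dE !Tnode//.
  have := small _ (node1 k); have := small _ (node1 k.+1).
  rewrite exprS !ltr_norml -signr_odd.
  by case: odd => /=; rewrite ?expr0 ?expr1; nra.
have x0rs : x0 \notin rs.
  apply/negP => /(allP ltrs)/=.
  by rewrite /node mul0r cos0 ltNge (ltW x0_gt1).
have := @max_poly_roots _ d (x0 :: rs) dn0.
by rewrite /= dx0 rrs urs x0rs srs ltnNge sd => /(_ isT isT).
Qed.

(** * Real polynomials on the imaginary axis *)

Lemma imaginary_sqr (R : realType) (y : R) :
  (0 +i* y : R[i]) ^+ 2 = (- y ^+ 2)%:C.
Proof.
by apply/eqP; rewrite eq_complex/= !expr2; apply/andP; split; apply/eqP; ring.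
Qed.

Lemma modulus_at_imaginary (R : realType) (p : {poly R}) (y : R) :
  modulus_at p (0 +i* y) =
  Num.sqrt ((even_poly p).[- y ^+ 2] ^+ 2 + ((odd_poly p).[- y ^+ 2] * y) ^+ 2).
Proof.
rewrite /modulus_at -{1}[p]poly_even_odd rmorphD rmorphM /= !map_comp_poly /=.
rewrite map_polyXn map_polyX hornerD hornerM !horner_comp hornerXn hornerX.
rewrite imaginary_sqr !horner_map/=; congr (Num.sqrt (_ ^+ 2 + _ ^+ 2)); ring.
Qed.

Lemma modulus_at_comp_sqr (R : realType) (p : {poly R}) (y : R) :
  modulus_at (p \Po 'X^2) (0 +i* y) = `|p.[- y ^+ 2]|.
Proof.
rewrite /modulus_at map_comp_poly /= map_polyXn horner_comp hornerXn.
by rewrite imaginary_sqr horner_map/= expr0n addr0 sqrtr_sqr.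
Qed.

Lemma even_le_modulus_at (R : realType) (p : {poly R}) (y : R) :
  `|(even_poly p).[- y ^+ 2]| <= modulus_at p (0 +i* y).
Proof.
by rewrite modulus_at_imaginary -sqrtr_sqr ler_wsqrtr// lerDl sqr_ge0.
Qed.

Lemma modulus_at_ge0 (R : realType) (p : {poly R}) (z : R[i]) :
  0 <= modulus_at p z.
Proof. by rewrite /modulus_at; case: horner => x y; rewrite sqrtr_ge0. Qed.

(** Even and odd parts are bounded on the disk of radius [b^2]. The bound is what makes [sup] over
    the segments an actual upper bound. *)
Lemma modulus_at_imaginary_bounded (R : realType) (p : {poly R}) (b : R) :
  exists M, forall y, `|y| <= b -> modulus_at p (0 +i* y) <= M.
Proof.
have [M1 HM1] := poly_disk_bound (even_poly p) (b ^+ 2).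
have [M2 HM2] := poly_disk_bound (odd_poly p) (b ^+ 2).
exists (Num.sqrt (M1 ^+ 2 + (M2 * b) ^+ 2)) => y yb.
have y2 : `|- y ^+ 2| <= b ^+ 2.
  by rewrite normrN normrX lerXn2r// nnegrE// (le_trans _ yb).
rewrite modulus_at_imaginary ler_wsqrtr//.
rewrite -(real_normK (num_real (even_poly _).[_])).
rewrite -(real_normK (num_real (_ * y))) normrM.
have ey := HM1 _ y2; have hy := HM2 _ y2.
have e_ge0 := le_trans (normr_ge0 _) ey.
have o_ge0 := le_trans (normr_ge0 _) hy.
have b0 := le_trans (normr_ge0 _) yb.
by rewrite lerD// lerXn2r ?nnegrE ?mulr_ge0// ler_pM.
Qed.

Lemma horner_even_poly0 (R : comNzRingType) (p : {poly R}) :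
  (even_poly p).[0] = p.[0].
Proof. by rewrite !horner_coef0 coef_even_poly. Qed.

(** * Growth of Chebyshev polynomials, segments and elementary inequalities *)

(** In the Joukowski form the second term satisfies [0 <= z^-n <= 1 <= z^n]. *)
Lemma chebyshev_joukowski_bounds (F : realFieldType) (n : nat) (z : F) :
  1 <= z ->
  z ^+ n / 2 <= (chebyshev F n).[(z + z^-1) / 2] <= z ^+ n.
Proof.
move=> z1; have z0 : 0 < z by exact: lt_le_trans z1.
rewrite chebyshev_joukowski ?gt_eqF//.
have zn1 : 1 <= z ^+ n by exact: exprn_ege1.
have : 0 <= z ^- n by rewrite invr_ge0 exprn_ge0 ?ltW.
have : z ^- n <= 1 by rewrite invf_le1// exprn_gt0.
by move=> *; apply/andP; split; lra.
Qed.

Lemma mem_imaginary_segment (R : realType) (u v y : R) : u < v ->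
  u <= y <= v -> segment (0 +i* u) (0 +i* v) (0 +i* y).
Proof.
move=> uv /andP[uy yv]; have vu : 0 < v - u by rewrite subr_gt0.
exists ((y - u) / (v - u)) => /=.
  by rewrite divr_ge0 ?subr_ge0 ?(ltW uv)//= ler_pdivrMr// mul1r lerD2r.
apply/eqP; rewrite eq_complex/=.
by apply/andP; split; apply/eqP; field; rewrite gt_eqF.
Qed.

Lemma imaginary_segment_param (R : realType) (u v : R) (z : R[i]) :
    segment (0 +i* u) (0 +i* v) z ->
  exists2 s, 0 <= s <= 1 & z = 0 +i* ((1 - s) * u + s * v).
Proof.
move=> [s /= s01 <-]; exists s => //.
by apply/eqP; rewrite eq_complex/=; apply/andP; split; apply/eqP; ring.
Qed.

Lemma bernoulli_le (R : realDomainType) (d : R) (n : nat) :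
  0 <= d -> 1 + n%:R * d <= (1 + d) ^+ n.
Proof.
move=> d0; elim: n => [|n IH]; first by rewrite mul0r addr0.
rewrite exprS -natr1; have : 0 <= n%:R :> R by rewrite ler0n.
have : 0 <= n%:R * d ^+ 2 by rewrite mulr_ge0// sqr_ge0.
by nra.
Qed.

Lemma powR_exprK (R : realType) (x : R) (n : nat) : 0 <= x -> (0 < n)%N ->
  (x ^+ n) `^ n%:R^-1 = x.
Proof.
move=> x0 n0; rewrite -powR_mulrn// -powRrM mulfV ?powRr1//.
by rewrite pnatr_eq0 -lt0n.
Qed.

(** * Lower and upper minimax bounds in each degree *)

Lemma kappa_gt0 (R : realFieldType) (a b : R) : 0 < a -> a < b ->
  0 < (b - a) / (b + a).
Proof. by move=> ha hab; apply: divr_gt0; lra. Qed.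

Lemma kappa_lt1 (R : realFieldType) (a b : R) : 0 < a -> a < b ->
  (b - a) / (b + a) < 1.
Proof. by move=> ha hab; rewrite ltr_pdivrMr; lra. Qed.

Lemma sqr_gap (R : realFieldType) (a b : R) : 0 < a -> a < b ->
  0 < b ^+ 2 - a ^+ 2.
Proof. by move=> ha hab; nra. Qed.

Lemma chebyshev_center_bounds (R : realFieldType) (a b : R) (n : nat) :
    0 < a -> a < b ->
  ((b - a) / (b + a)) ^- n / 2
    <= (chebyshev R n).[(b ^+ 2 + a ^+ 2) / (b ^+ 2 - a ^+ 2)]
    <= ((b - a) / (b + a)) ^- n.
Proof.
move=> ha hab.
have k1 : 1 <= ((b - a) / (b + a))^-1.
  by rewrite invf_ge1 ?kappa_gt0// ltW// kappa_lt1.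
have -> : (b ^+ 2 + a ^+ 2) / (b ^+ 2 - a ^+ 2) =
    (((b - a) / (b + a))^-1 + ((b - a) / (b + a))^-1^-1) / 2.
  rewrite subr_sqr; field.
  by apply/andP; split; apply/negP => /eqP; lra.
by have := chebyshev_joukowski_bounds n k1; rewrite exprVn.
Qed.

Lemma normalized_poly_large (R : realType) (a b : R) (t : nat)
    (p : {poly R}) :
    0 < a -> a < b -> normalized_polys t p ->
  exists2 y, a <= y <= b & ((b - a) / (b + a)) ^+ t./2 <= modulus_at p (0 +i* y).
Proof.
move=> ha hab [sp p0].
have [T1 T2] := andP (chebyshev_center_bounds t./2 ha hab).
have kn : 0 < ((b - a) / (b + a)) ^+ t./2 by rewrite exprn_gt0// kappa_gt0.
set kappa := (b - a) / (b + a) in T1 T2 kn *.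
have gap := sqr_gap ha hab.
set x0 := (b ^+ 2 + a ^+ 2) / (b ^+ 2 - a ^+ 2) in T1 T2.
(* Affine map taking [[-1, 1]] onto [[-b^2, -a^2]] and [x0] to 0, so that the normalization at 0
   becomes [q.[x0] = 1]. *)
pose l : {poly R} :=
  ((b ^+ 2 - a ^+ 2) / 2) *: 'X - ((b ^+ 2 + a ^+ 2) / 2)%:P.
have lE x : l.[x] = ((b ^+ 2 - a ^+ 2) * x - (b ^+ 2 + a ^+ 2)) / 2.
  by rewrite !hornerE; field.
have sl : (size l <= 2)%N.
  rewrite (leq_trans (size_polyD _ _))// geq_max size_polyN.
  rewrite (leq_trans (size_scale_leq _ _)) ?size_polyX//=.
  by rewrite (leq_trans (size_polyC_leq1 _)).
have se : (size (even_poly p) <= t./2.+1)%N.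
  by rewrite (leq_trans (size_even_poly _))// (leq_trans (uphalf_leq sp)).
have sq : (size (even_poly p \Po l) <= t./2.+1)%N.
  by have := size_comp_poly_le se sl; rewrite muln1.
have x0_gt1 : 1 < x0 by rewrite /x0 ltr_pdivlMr//; nra.
have qx0 : (even_poly p \Po l).[x0] = 1.
  rewrite horner_comp lE /x0 -[RHS]p0 -horner_even_poly0; congr (_.[_]).
  by field; rewrite gt_eqF.
have [x /andP[x1 x2]] := chebyshev_extremal sq x0_gt1 qx0.
rewrite horner_comp normrM => large.
have lx : - b ^+ 2 <= l.[x] <= - a ^+ 2 by rewrite lE; apply/andP; split; nra.
have /andP[lx1 lx2] := lx.
have lxn : 0 <= - l.[x] by nra.
(* This [y] satisfies [- y^2 = l.[x]], which brings the extremal point back to the segment. *)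
exists (Num.sqrt (- l.[x])).
  rewrite -[a](ger0_norm (ltW ha)) -[b]ger0_norm -?sqrtr_sqr; last lra.
  by rewrite !ler_wsqrtr//; lra.
rewrite (le_trans _ (even_le_modulus_at _ _))// sqr_sqrtr// opprK.
have Tpos : 0 < (chebyshev R t./2).[x0].
  by rewrite (lt_le_trans _ T1)// divr_gt0// invr_gt0.
move: large; rewrite gtr0_norm// => large.
rewrite -[leLHS]mulr1 -ler_pdivlMl//.
by rewrite (le_trans large)// ler_wpM2r.
Qed.

(** The witness is [T_n (l (X^2)) / T_n(x0)]. Its numerator is at most 1 in modulus on the segments,
    and [T_n(x0) >= 1 / (2 k^n)] yields the factor 2. *)
Lemma normalized_poly_small (R : realType) (a b : R) (n : nat) :
    0 < a -> a < b ->
  exists2 p : {poly R}, normalized_polys n.*2 p &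
    forall y, a <= `|y| <= b ->
      modulus_at p (0 +i* y) <= 2 * ((b - a) / (b + a)) ^+ n.
Proof.
move=> ha hab; have [T1 T2] := andP (chebyshev_center_bounds n ha hab).
have kn : 0 < ((b - a) / (b + a)) ^+ n by rewrite exprn_gt0// kappa_gt0.
set kappa := (b - a) / (b + a) in T1 T2 kn *.
have gap := sqr_gap ha hab.
set x0 := (b ^+ 2 + a ^+ 2) / (b ^+ 2 - a ^+ 2) in T1 T2.
have Tpos : 0 < (chebyshev R n).[x0].
  by rewrite (lt_le_trans _ T1)// divr_gt0// invr_gt0.
(* Inverse of the affine map of the lower bound: [[-b^2, -a^2]] goes onto [[-1, 1]] and 0 to
   [x0]. *)
pose l : {poly R} := (2 / (b ^+ 2 - a ^+ 2)) *: 'X + x0%:P.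
have lE x : l.[x] = (b ^+ 2 + a ^+ 2 + 2 * x) / (b ^+ 2 - a ^+ 2).
  by rewrite !hornerE /x0; field; rewrite gt_eqF.
have sl : (size l <= 2)%N.
  rewrite (leq_trans (size_polyD _ _))// geq_max.
  rewrite (leq_trans (size_scale_leq _ _)) ?size_polyX//=.
  by rewrite (leq_trans (size_polyC_leq1 _)).
pose r := (chebyshev R n).[x0]^-1 *: (chebyshev R n \Po l).
have rE (x : R) : r.[x] = (chebyshev R n).[x0]^-1 * (chebyshev R n).[l.[x]].
  by rewrite hornerZ horner_comp.
have sr : (size r <= n.+1)%N.
  rewrite (leq_trans (size_scale_leq _ _))//.
  by have := size_comp_poly_le (size_chebyshev R n) sl; rewrite muln1.
exists (r \Po 'X^2).
  split.
    have sX : (size ('X^2 : {poly R}) <= 3)%N by rewrite size_polyXn.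
    by have := size_comp_poly_le sr sX; rewrite muln2.
  rewrite horner_comp hornerXn expr0n/= rE lE mulr0 addr0 -/x0 mulVf//.
  by rewrite gt_eqF.
move=> y /andP[ay yb]; rewrite modulus_at_comp_sqr rE normrM.
have y1 : a ^+ 2 <= y ^+ 2.
  by rewrite -[leRHS]real_normK ?num_real// lerXn2r ?nnegrE// ltW.
have y2 : y ^+ 2 <= b ^+ 2.
  by rewrite -[leLHS]real_normK ?num_real// lerXn2r ?nnegrE//; lra.
have l1 : -1 <= l.[- y ^+ 2] <= 1.
  by rewrite lE ler_pdivlMr// ler_pdivrMr//; apply/andP; split; lra.
rewrite -[leRHS]mulr1 ler_pM ?chebyshev_le1// normfV gtr0_norm//.
rewrite -[2 * _]invrK lef_pV2 ?posrE// ?invr_gt0 ?mulr_gt0//.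
by rewrite invfM mulrC.
Qed.

(** * Passage to the infimum over all degrees *)

Unset Implicit Arguments.

Theorem proposition5 (R : realType) (a b : R) (ha : 0 < a) (hab : a < b) :
  asymptotic_convergence_factor
    (segment (0 +i* a) (0 +i* b) `|` segment (0 -i* a) (0 -i* b))
  = Num.sqrt ((b - a) / (b + a)).
Proof.
set K := _ `|` _.
have inK y : a <= y <= b -> K (0 +i* y).
  by move=> yab; left; exact: mem_imaginary_segment.
have Kim z : K z -> exists2 y, a <= `|y| <= b & z = 0 +i* y.
  move=> [|] /imaginary_segment_param[s /andP[s0 s1] ->].
    exists ((1 - s) * a + s * b) => //.
    by rewrite ger0_norm; [apply/andP; split|]; nra.
  exists ((1 - s) * - a + s * - b) => //.
  by rewrite ler0_norm; [apply/andP; split|]; nra.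
have k0 := kappa_gt0 ha hab; have k1 := kappa_lt1 ha hab.
pose s := Num.sqrt ((b - a) / (b + a)).
have s0 : 0 < s by rewrite sqrtr_gt0.
have s1 : s <= 1 by rewrite -sqrtr1 ler_wsqrtr// ltW.
have s2 : (b - a) / (b + a) = s ^+ 2 by rewrite sqr_sqrtr// ltW.
rewrite -/s.
pose supK t p := sup [set modulus_at p z `^ (t%:R)^-1 | z in K].
have ge_s t p : (0 < t)%N -> normalized_polys t p -> s <= supK t p.
  move=> t0 Pp; have [y yab large] := normalized_poly_large ha hab Pp.
  have mono (u v : R) : 0 <= u -> u <= v -> u `^ (t%:R)^-1 <= v `^ (t%:R)^-1.
    by move=> u0 uv; rewrite ge0_ler_powR ?nnegrE ?invr_ge0// (le_trans u0).
  apply: (@le_trans _ _ (modulus_at p (0 +i* y) `^ (t%:R)^-1)).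
    rewrite -[leLHS](powR_exprK (ltW s0) t0).
    apply: mono; first by rewrite exprn_ge0// ltW.
    (* For odd [t] the exponent [2 * t./2] is [t - 1]; as [s <= 1], the power [s^t] is still a lower
       bound. *)
    rewrite (le_trans _ large)// s2 -exprM ler_wiXn2l// ?(ltW s0)//.
    by rewrite mul2n -[leqRHS]odd_double_half leq_addl.
  apply: ub_le_sup; last by exists (0 +i* y) => //; exact: inK.
  have [M HM] := modulus_at_imaginary_bounded p b.
  exists (M `^ (t%:R)^-1) => _ [z /Kim[w /andP[_ wb] ->] <-].
  by rewrite mono ?modulus_at_ge0// HM.
have supK_lb t : (0 < t)%N -> lbound [set supK t p | p in normalized_polys t] s.
  by move=> t0 _ [p Pp <-]; exact: ge_s.
have inf_ge t : (0 < t)%N -> s <= inf [set supK t p | p in normalized_polys t].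
  move=> t0; apply: lb_le_inf; last exact: supK_lb.
  (* The constant polynomial 1 shows that the set is nonempty, as a lower bound on its [inf]
     requires. *)
  by exists (supK t 1), 1 => //; split; rewrite ?size_poly1 ?hornerC.
apply/eqP; rewrite eq_le; apply/andP; split; last first.
  apply: lb_le_inf; last by move=> _ [t /= t0 <-]; exact: inf_ge.
  by exists (inf [set supK 1%N p | p in normalized_polys 1]), 1%N.
apply/ler_addgt0Pr => e e0.
pose d := e / s; have d0 : 0 < d by rewrite divr_gt0.
have -> : s + e = s * (1 + d) by rewrite /d; field; rewrite gt_eqF.
(* With [n * d >= 1], Bernoulli gives [(1 + d)^n >= 2], enough to absorb the factor 2 of the upper
   bound in degree [2n]. *)
pose n := Num.bound d^-1.
have nd : 1 <= n%:R * d.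
  rewrite -ler_pdivrMr// mul1r ltW//.
  by rewrite archi_boundP// invr_ge0 ltW.
have n0 : (0 < n)%N by rewrite lt0n; apply: contraTneq nd => ->; lra.
have [p Pp small] := normalized_poly_small n ha hab.
have t0 : (0 < n.*2)%N by rewrite double_gt0.
apply: (@le_trans _ _ (inf [set supK n.*2 p | p in normalized_polys n.*2])).
  apply: ge_inf; last by exists n.*2.
  (* The lower bound already proved shows that the set is bounded below, so its [inf] lies below
     each element. *)
  by exists s => _ [t /= ? <-]; exact: inf_ge.
apply: (@le_trans _ _ (supK n.*2 p)).
  by apply: ge_inf; [exists s; exact: supK_lb|exists p].
apply: ge_sup.
  exists (modulus_at p (0 +i* a) `^ (n.*2%:R)^-1), (0 +i* a) => //.
  by apply: inK; rewrite lexx ltW.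
move=> _ [z /Kim[y yab ->] <-].
have sd : 0 <= s * (1 + d) by rewrite mulr_ge0 ?addr_ge0 ?ltW.
rewrite -[leRHS](powR_exprK sd t0) ge0_ler_powR ?nnegrE ?invr_ge0//.
- exact: modulus_at_ge0.
- exact: exprn_ge0.
rewrite (le_trans (small _ yab))// s2 -exprM mul2n exprMn mulrC.
rewrite ler_wpM2l ?exprn_ge0 ?(ltW s0)//.
have dd := bernoulli_le n (ltW d0).
have d1 : 1 <= (1 + d) ^+ n by apply: exprn_ege1; lra.
(* One factor [(1 + d)^n] is at least 2 and the other at least 1. *)
by rewrite -addnn exprD; nra.
Qed.
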